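(* Two complete bipartite graphs $K_{n_1,n_2}$ and $K_{n_1',n_2'}$ are isomorphic if and only if they have the same path sequence.
   Context: Graphs are finite and simple. $K_{n_1,n_2}$ ($n_1,n_2\ge1$) is the complete bipartite graph with parts of sizes $n_1$ and $n_2$. A path of length $h$ in $G$ is a subgraph that is a path with $h$ edges ($h+1$ distinct vertices); paths are undirected, and paths of length $0$ are single vertices. $P_h(G)$ is the number of paths of length $h$ in $G$. The path sequence of $G$ is $P(G)=(P_0(G),P_1(G),\ldots,P_\rho(G))$, where $\rho=\rho(G)$ is the length of a longest path in $G$. *)

(* Defs.v *)
From HB Require Import structures.
From mathcomp Require Import all_boot.
Set Implicit Arguments.
Unset Strict Implicit.
Unset Printing Implicit Defensive.

Record sgraph := SGraph {
  vertex :> finType;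
  adj : rel vertex;
  adj_sym : symmetric adj;
  adj_irrefl : irreflexive adj
}.

Definition isomorphic (G H : sgraph) : Prop :=
  exists2 f : G -> H, bijective f & forall x y, adj (f x) (f y) = adj x y.

Definition Kadj (m n : nat) : rel ('I_m + 'I_n)%type :=
  fun u v => match u, v with
             | inl _, inr _ | inr _, inl _ => true
             | _, _ => false
             end.

Lemma Kadj_sym m n : symmetric (@Kadj m n).
Proof. by case=> ? []. Qed.

Lemma Kadj_irrefl m n : irreflexive (@Kadj m n).
Proof. by case. Qed.

Definition complete_bipartite (m n : nat) : sgraph :=
  SGraph (@Kadj_sym m n) (@Kadj_irrefl m n).

Section Paths.
Variable G : sgraph.

(* The vertex set and the edge set of the walk x, p_1, ..., p_h; edges are
   unordered pairs, so a walk and its reversal give the same sets. *)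
Definition walk_vertices (x : G) (p : seq G) : {set G} := [set z in x :: p].

Definition walk_edges (x : G) (p : seq G) : {set {set G}} :=
  [set [set e.1; e.2] | e in zip (x :: p) p].

(* A pair (V, E) is a path subgraph with h edges if it is traced by some walk
   of G through h + 1 distinct vertices. *)
Definition is_path (h : nat) (S : {set G} * {set {set G}}) : bool :=
  [exists x : G, exists p : h.-tuple G,
     [&& path (@adj G) x p, uniq (x :: p),
         S.1 == walk_vertices x p & S.2 == walk_edges x p]].

Definition num_paths (h : nat) : nat := #|[pred S | is_path h S]|.

(* A path has distinct vertices, so its length is less than #|G|; this is why
   h only ranges over 'I_#|G|. *)
Definition longest_path : nat :=
  \max_(h < #|G| | [exists S, is_path h S]) h.

Definition path_sequence : seq nat := mkseq num_paths longest_path.+1.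

End Paths.

(* Main.v *)
(** Only the first two terms are needed: [P_0 = n1 + n2] and [P_1 = n1 * n2]
    determine the unordered pair [{n1, n2}] as the roots of a quadratic. *)
Require Import Defs.
From HB Require Import structures.
From mathcomp Require Import all_boot.
From mathcomp Require Import zify.
Set Implicit Arguments.
Unset Strict Implicit.
Unset Printing Implicit Defensive.

(** An isomorphism and its inverse both send paths injectively to paths of the same length, so every
    path count and the maximal length are invariant ([isomorphic_path_sequence]). Conversely, in a
    complete bipartite graph P_0 counts the vertices, giving the sum of the part sizes, and P_1
    counts the edges, giving their product ([num_paths0], [num_paths1_complete_bipartite]). Sum and
    product determine the sizes up to order ([eq_sum_prod]), and exchanging the two parts is an
    isomorphism. *)

Lemma isomorphic_sym (G H : sgraph) : isomorphic G H -> isomorphic H G.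
Proof.
case=> f [g fK gK] f_adj; exists g; first by exists f.
by move=> x y; rewrite -f_adj !gK.
Qed.

Lemma zip_map_pair (A B A' B' : Type) (f : A -> A') (g : B -> B') s t :
  zip (map f s) (map g t) = [seq (f e.1, g e.2) | e <- zip s t].
Proof. by elim: s t => [|a s IHs] [|b t] //=; rewrite IHs. Qed.

Section WalkImage.
Variables (G H : sgraph) (f : G -> H).

Lemma walk_vertices_map (x : G) (p : seq G) :
  walk_vertices (f x) (map f p) = f @: walk_vertices x p.
Proof.
apply/setP=> z; rewrite inE -map_cons; apply/mapP/imsetP=> -[y].
  by exists y; rewrite // inE.
by rewrite inE; exists y.
Qed.

Lemma walk_edges_map (x : G) (p : seq G) :
  walk_edges (f x) (map f p) = [set f @: e | e : {set G} in walk_edges x p].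
Proof.
have -> : walk_edges (f x) (map f p) =
    [set [set e.1; e.2] | e in [seq (f e.1, f e.2) | e <- zip (x :: p) p]].
  by rewrite /walk_edges -map_cons; rewrite zip_map_pair.
apply/setP=> E; apply/imsetP/imsetP.
  move=> [_ /mapP[e ep ->] ->]; exists [set e.1; e.2]; first exact: imset_f.
  by rewrite imsetU1 imset_set1.
move=> [_ /imsetP[e ep ->] ->]; exists (f e.1, f e.2); first exact: map_f.
by rewrite imsetU1 imset_set1.
Qed.

Hypotheses (f_inj : injective f)
           (f_adj : forall x y, adj (f x) (f y) = adj x y).

Lemma is_path_image h S :
  is_path h S -> is_path h (f @: S.1, [set f @: e | e : {set G} in S.2]).
Proof.
case/existsP=> x /existsP[p /and4P[xp xp_uniq /eqP-> /eqP->]].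
apply/existsP; exists (f x); apply/existsP; exists (map_tuple f p).
rewrite path_map (eq_path (e' := @adj G)) // xp -map_cons map_inj_uniq //.
by rewrite xp_uniq /= walk_vertices_map walk_edges_map !eqxx.
Qed.

(** Taking images under [f] is injective on vertex sets, hence on edge sets, and sends paths to
    paths. The one-sided bound becomes an equality when applied to an isomorphism and to its
    inverse. *)
Lemma leq_num_paths h : num_paths G h <= num_paths H h.
Proof.
pose F (S : {set G} * {set {set G}}) :=
  (f @: S.1, [set f @: e | e : {set G} in S.2]).
have F_inj : injective F.
  have img_inj := imset_inj f_inj.
  by move=> [V E] [V' E'] [/img_inj-> /(imset_inj img_inj)->].
rewrite /num_paths -(card_image F_inj); apply/subset_leq_card/subsetP=> _ /imageP[S Sp ->].
exact: is_path_image.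
Qed.

Lemma leq_longest_path : longest_path G <= longest_path H.
Proof.
apply/bigmax_leqP=> i /existsP[S /is_path_image Sp].
(* The maximum for [H] ranges over indices below [#|H|], so the length must be moved into that
   range. *)
have iH : i < #|H| by apply: leq_trans (ltn_ord i) (leq_card f f_inj).
by apply: (leq_bigmax_cond (Ordinal iH)); apply/existsP; eexists; exact: Sp.
Qed.

End WalkImage.

Lemma isomorphic_path_sequence (G H : sgraph) :
  isomorphic G H -> path_sequence G = path_sequence H.
Proof.
move=> GH; case: (GH) (isomorphic_sym GH) => f /bij_inj f_inj f_adj.
case=> g /bij_inj g_inj g_adj.
have num_eq : num_paths G =1 num_paths H.
  move=> h; apply/eqP; rewrite eqn_leq.
  by rewrite (leq_num_paths f_inj f_adj) (leq_num_paths g_inj g_adj).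
rewrite /path_sequence; suff -> : longest_path G = longest_path H.
  exact: eq_mkseq.
apply/eqP; rewrite eqn_leq.
by rewrite (leq_longest_path f_inj f_adj) (leq_longest_path g_inj g_adj).
Qed.

Lemma walk_vertices1 (G : sgraph) (x y : G) :
  walk_vertices x [:: y] = [set x; y].
Proof. by apply/setP=> z; rewrite !inE. Qed.

Lemma walk_edges1 (G : sgraph) (x y : G) :
  walk_edges x [:: y] = [set [set x; y]].
Proof.
apply/setP=> E; rewrite inE; apply/imsetP/eqP=> [[e]|->].
  by rewrite inE => /eqP->.
by exists (x, y); rewrite // inE.
Qed.

Lemma num_paths0 (G : sgraph) : num_paths G 0 = #|G|.
Proof.
pose F (x : G) : {set G} * {set {set G}} := ([set x], set0).
have F_inj : injective F by move=> x y [/set1_inj].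
have walk0 x : (walk_vertices x [::], walk_edges x [::]) = F x.
  congr pair; first by apply/setP=> z; rewrite !inE.
  by apply/setP=> E; rewrite inE; apply/imsetP=> -[].
rewrite -(card_image F_inj); apply: eq_card => -[V E].
apply/existsP/imageP=> [[x /existsP[p]]|[x _ ->]].
  by rewrite tuple0 => /and4P[_ _ /eqP/= -> /eqP/= ->]; exists x.
exists x; apply/existsP; exists [tuple].
by have [-> ->] := walk0 x; rewrite /= !eqxx.
Qed.

(** Reduces P_1 to counting edges; irreflexivity of [adj] makes the two endpoints distinct. *)
Lemma is_path1P (G : sgraph) (S : {set G} * {set {set G}}) :
  reflect (exists x y : G, adj x y /\ S = ([set x; y], [set [set x; y]]))
          (is_path 1 S).
Proof.
apply: (iffP existsP) => [[x /existsP[p]]|[x [y [xy ->]]]].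
  case/tupleP: p => y p; rewrite (tuple0 p) /= walk_vertices1 walk_edges1.
  case/and4P=> /andP[xy _] _ /eqP S1 /eqP S2.
  by exists x, y; split=> //; rewrite [S]surjective_pairing S1 S2.
exists x; apply/existsP; exists [tuple y].
rewrite /= walk_vertices1 walk_edges1 xy !eqxx !inE !andbT /=.
by apply: contraTneq xy => ->; rewrite adj_irrefl.
Qed.

Section CompleteBipartite.
Variables m n : nat.
Local Notation K := (complete_bipartite m n).

Lemma num_paths1_complete_bipartite : num_paths K 1 = m * n.
Proof.
pose e (u : 'I_m * 'I_n) : {set K} := [set inl u.1; inr u.2].
pose F u : {set K} * {set {set K}} := (e u, [set e u]).
have F_inj : injective F.
  move=> [i j] [i' j'] [/setP eq_e _].
  (* An edge meets each part exactly once, so its vertex in each part recovers one coordinate. *)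
  move: (eq_e (inl i)) (eq_e (inr j)); rewrite !inE !eqxx /= orbF.
  by move=> /esym/eqP[->] /esym/eqP[->].
transitivity #|{: 'I_m * 'I_n}|; last by rewrite card_prod !card_ord.
rewrite -(card_image F_inj); apply: eq_card => S.
apply/is_path1P/imageP=> [[x [y [xy ->]]]|[[i j] _ ->]].
  (* The edge may be traced from either part; both directions give the same unordered pair. *)
  case: x y xy => [i|j] [i'|j'] //= _; first by exists (i, j').
  by exists (i', j); rewrite // /F /e setUC.
by exists (inl i), (inr j).
Qed.

Lemma longest_path_complete_bipartite_gt0 :
  0 < m -> 0 < n -> 0 < longest_path K.
Proof.
move=> m_gt0 n_gt0.
have K_gt1 : 1 < #|K| by rewrite card_sum !card_ord; lia.
apply: (leq_bigmax_cond (Ordinal K_gt1)); apply/existsP.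
eexists; apply/is_path1P.
by exists (inl (Ordinal m_gt0)), (inr (Ordinal n_gt0)).
Qed.

Lemma complete_bipartite_swap : isomorphic K (complete_bipartite n m).
Proof.
pose swap a b (x : 'I_a + 'I_b) : 'I_b + 'I_a :=
  match x with inl i => inr i | inr j => inl j end.
exists (swap m n); last by case=> ? [].
by exists (swap n m); case.
Qed.

End CompleteBipartite.

Lemma isomorphic_refl (G : sgraph) : isomorphic G G.
Proof. by exists id => //; exists id. Qed.

(** The hypotheses give (a - c)(a - d) = a^2 - (a + b)a + ab = 0 over the integers. *)
Lemma eq_sum_prod (a b c d : nat) :
  a + b = c + d -> a * b = c * d -> a = c /\ b = d \/ a = d /\ b = c.
Proof.
move=> eq_sum eq_prod; have [eq_ac|neq_ac] := eqVneq a c; first by left; lia.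
by right; nia.
Qed.

Theorem corollary4 (n1 n2 n1' n2' : nat)
  (hn1 : 1 <= n1) (hn2 : 1 <= n2) (hn1' : 1 <= n1') (hn2' : 1 <= n2') :
  isomorphic (complete_bipartite n1 n2) (complete_bipartite n1' n2') <->
  path_sequence (complete_bipartite n1 n2) =
  path_sequence (complete_bipartite n1' n2').
Proof.
split=> [|eq_seq]; first exact: isomorphic_path_sequence.
have nthP h := congr1 (fun s => nth 0 s h) eq_seq.
(* A positive longest length makes index 1 a true entry of each sequence, so that [nth] returns P_1
   and not the default 0. *)
have rho := longest_path_complete_bipartite_gt0 hn1 hn2.
have rho' := longest_path_complete_bipartite_gt0 hn1' hn2'.
move: (nthP 0) (nthP 1); rewrite !nth_mkseq // !num_paths0.
rewrite !num_paths1_complete_bipartite !card_sum !card_ord.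
move=> eq_sum /(eq_sum_prod eq_sum)[] [-> ->].
  exact: isomorphic_refl.
exact: complete_bipartite_swap.
Qed.
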